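(* Let $n\ge0$. (1) The variety $V(2+\alpha_n)_{1,1}$ consists of two points $(b_1,a_1)$, with $$a_1=\pm2\sqrt{1+\alpha_n}\quad\text{and}\quad b_1=a_1/2.$$ It has no points rational over $\mathbb{Q}(\alpha_n)$ if $n\ge1$. The PCF variety $V(2)_{1,1}$ (the case $n=0$) consists of the two points $(b_1,a_1)=\pm(1,2)$. (2) There are no $\mathbb{Z}[\alpha_n]$-PCFs of type $(1,1)$ for $\alpha_{n+1}$ if $n\ge1$. If $n=0$, there is precisely one: $\sqrt2=[1,\overline{2}]$.
   Context: For $n\ge-1$, $\alpha_n=2\cos(2\pi/2^{n+2})$, so $\alpha_0=0$, $\alpha_1=\sqrt2$ and $\alpha_{n+1}^2=2+\alpha_n$. Put $D(c)=\begin{bmatrix}c&1\\1&0\end{bmatrix}$ and $\begin{bmatrix}E_{11}&E_{12}\\ E_{21}&E_{22}\end{bmatrix}=D(y_1)D(x_1)D(y_1)^{-1}=\begin{bmatrix}y_1&x_1y_1+1-y_1^2\\1&x_1-y_1\end{bmatrix}$. The PCF variety $V(2+\alpha_n)_{1,1}\subseteq\mathbb{A}^1\times\mathbb{A}^1$ (coordinates $(y_1,x_1)$, points written $(b_1,a_1)$), associated with the polynomial $x^2-(2+\alpha_n)$, is defined by $A(E_{22}-E_{11})=BE_{21}$, $-AE_{12}=CE_{21}$, $-BE_{12}=C(E_{22}-E_{11})$ for $(A,B,C)=(1,0,-(2+\alpha_n))$. A $\mathbb{Z}[\alpha_n]$-PCF of type $(1,1)$ for $\alpha_{n+1}$ is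 a periodic continued fraction $[b_1,\overline{a_1}]=[b_1,a_1,a_1,\ldots]$ with $b_1,a_1\in\mathbb{Z}[\alpha_n]$ whose value is $\alpha_{n+1}$. With partial quotients $c_1,c_2,\ldots=b_1,a_1,a_1,\ldots$, the $m$-th convergent is $M_{11}/M_{21}\in\mathbb{P}^1(\mathbb{C})$ with $M=D(c_1)\cdots D(c_m)$, and the value is the limit of the convergents in $\mathbb{P}^1(\mathbb{C})$, if it exists. *)

(* Defs.v *)
From HB Require Import structures.
From mathcomp Require Import all_boot all_order all_algebra.
From mathcomp Require Import all_classical all_reals all_analysis.
From mathcomp Require Import complex.

Set Implicit Arguments.
Unset Strict Implicit.
Unset Printing Implicit Defensive.

Import Order.TTheory GRing.Theory Num.Theory.
Import numFieldNormedType.Exports.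

Local Open Scope classical_set_scope.
Local Open Scope complex_scope.
Local Open Scope ring_scope.

Definition alpha (R : realType) (n : nat) : R[i] :=
  (2 * cos (2 * pi / 2 ^+ n.+2))%:C.

(* Z[x] and Q(x): the subring and the subfield of F generated by x. In
   characteristic 0 every subfield contains Q. *)
Definition subring_gen (F : fieldType) (x : F) : set F :=
  smallest [set A : set F | subring_closed [in A]] [set x].

Definition subfield_gen (F : fieldType) (x : F) : set F :=
  smallest [set A : set F | divring_closed [in A]] [set x].

Definition Dmx (F : fieldType) (c : F) : 'M[F]_2 :=
  \matrix_(i, j) (if i == 0 then if j == 0 then c else 1
                  else if j == 0 then 1 else 0).

Definition Emx (F : fieldType) (y x : F) : 'M[F]_2 :=
  Dmx y *m Dmx x *m invmx (Dmx y).

(* F-points (y_1, x_1) of the PCF variety of type (1,1) of A x^2 + B x + C;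
   matrix indices are 0-based, so E_11 is E 0 0. *)
Definition PCF_variety11 (F : fieldType) (A B C : F) : set (F * F) :=
  [set p | let E := Emx p.1 p.2 in
    [/\ A * (E 1 1 - E 0 0) = B * E 1 0,
        - (A * E 0 1) = C * E 1 0 &
        - (B * E 0 1) = C * (E 1 1 - E 0 0)]].

(* V(c)_{1,1}, associated with x^2 - c *)
Definition V11 (F : fieldType) (c : F) : set (F * F) :=
  PCF_variety11 1 0 (- c).

(* Partial quotients of [b, a, a, ...]; here c_1, c_2, ... is indexed from 0. *)
Definition pcf11 (F : fieldType) (b a : F) (i : nat) : F :=
  if i is 0%N then b else a.

(* The m-th convergent M_11 / M_21 in the projective line K \cup {oo}, modelled
   by the one-point compactification of K, with oo = None. The first column of
   M never vanishes, since \det M = (-1)^m. *)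
Definition convergent (K : numFieldType) (c : nat -> K) (m : nat) :
    one_point_compactification K :=
  let M := \prod_(i < m) Dmx (c i) in
  if M 1 0 == 0 then None else Some (M 0 0 / M 1 0).

Definition cf_value (K : numFieldType) (c : nat -> K)
    (z : one_point_compactification K) : Prop :=
  convergent c m @[m --> \oo] --> z.

(* [b, a, a, ...] is a Z[alpha_n]-PCF of type (1,1) for alpha_{n+1}. *)
Definition is_PCF11 (R : realType) (n : nat) (b a : R[i]) : Prop :=
  [/\ subring_gen (alpha R n) b, subring_gen (alpha R n) a &
      cf_value (pcf11 b a) (Some (alpha R n.+1))].

(* Main.v *)
(* Matching entries shows that V(2 + alpha_n)_{1,1} is x = 2y, y^2 = 1 + alpha_n.
   Set F_0 = Q and F_{n+1} = F_n(alpha_{n+1}). Taking norms from F_{n+1} to F_n,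
   2 +- alpha_{n+1} has norm 4 - alpha_{n+1}^2 = 2 - alpha_n, so by induction
   neither 2 + alpha_n nor 2 - alpha_n is a square in F_n, and each step of the
   tower is a genuine quadratic extension. If 1 + alpha_n were a square in F_n
   for n >= 1, its conjugate 1 - alpha_n < 0 would be the square of a real
   number. For part (2), the value of a continued fraction of type (1,1) is
   fixed by the Moebius action of E; since alpha_{n+1} is not in F_n, the
   coefficients of its quadratic equation must match, which places (b, a) on the
   variety. For n = 0 the two points +-(1, 2) give the values +-sqrt 2. *)
Require Import Defs.
From HB Require Import structures.
From mathcomp Require Import all_boot all_order all_algebra.
From mathcomp Require Import all_classical all_reals all_analysis.
From mathcomp Require Import complex.
From mathcomp Require Import ring lra.

Set Implicit Arguments.
Unset Strict Implicit.
Unset Printing Implicit Defensive.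

Import Order.TTheory GRing.Theory Num.Theory.
Import numFieldNormedType.Exports.

Local Open Scope classical_set_scope.
Local Open Scope complex_scope.
Local Open Scope ring_scope.

(** * Adjoining a square root [a] to a subfield [A] *)

Definition quad_ext (K : fieldType) (A : set K) (a : K) : set K :=
  [set x | exists u v, [/\ A u, A v & x = u + v * a]].

Section QuadraticExtension.
Variables (K : fieldType) (A : set K) (a : K).
Hypothesis (Acl : divring_closed [in A]).
Hypotheses (Aa2 : A (a ^+ 2)) (Aa : forall z, A z -> z ^+ 2 <> a ^+ 2).

Let P : {pred K} := [in A].
#[local] HB.instance Definition _ := GRing.isDivringClosed.Build K P Acl.

Let AP x : A x = (x \in P) :> Prop. Proof. by rewrite in_setE. Qed.

(** A nonzero [v] would make [a = - (u / v)] an element of [A], against [Aa]. *)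
Lemma quad_ext_eq0 u v : A u -> A v -> u + v * a = 0 -> u = 0 /\ v = 0.
Proof.
move=> Au Av uva.
have [v0|v_neq0] := eqVneq v 0; first by move: uva; rewrite v0 mul0r addr0.
have /Aa[] : A (u / v) by move: Au Av; rewrite !AP; exact: rpred_div.
have -> : a = - (u / v).
  by apply: (mulfI v_neq0); rewrite -[LHS](addKr u) uva; field.
by rewrite sqrrN.
Qed.

Lemma quad_ext_inj u v u' v' : A u -> A v -> A u' -> A v' ->
  u + v * a = u' + v' * a -> u = u' /\ v = v'.
Proof.
move=> Au Av Au' Av' uva.
have [/subr0_eq-> /subr0_eq-> //] : u - u' = 0 /\ v - v' = 0.
apply: quad_ext_eq0.
- by move: Au Au'; rewrite !AP; exact: rpredB.
- by move: Av Av'; rewrite !AP; exact: rpredB.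
- by rewrite mulrBl addrACA -opprD uva subrr.
Qed.

Lemma quad_ext_base u : A u -> quad_ext A a u.
Proof. by move=> Au; exists u, 0; rewrite mul0r addr0 !AP rpred0 -AP. Qed.

Lemma quad_ext_gen : quad_ext A a a.
Proof. by exists 0, 1; rewrite mul1r add0r !AP rpred0 rpred1. Qed.

Lemma quad_ext_closed : divring_closed [in quad_ext A a].
Proof.
split.
- by apply/mem_set/quad_ext_base; rewrite AP rpred1.
- move=> _ _ /set_mem[u [v [Au Av ->]]] /set_mem[u' [v' [Au' Av' ->]]].
  apply/mem_set; exists (u - u'), (v - v'); rewrite !AP in Au Av Au' Av' *.
  by split; [exact: rpredB..|ring].
- move=> _ _ /set_mem[u [v [Au Av ->]]] /set_mem[u' [v' [Au' Av' ->]]].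
  apply/mem_set.
  have [x0|x_neq0] := eqVneq (u' + v' * a) 0.
    by rewrite x0 invr0 mulr0; apply: quad_ext_base; rewrite AP rpred0.
  (* [N] is the norm of the divisor. The conjugate is nonzero, since by independence it vanishes
     only when [u'] and [v'] both do. *)
  pose N := u' ^+ 2 - v' ^+ 2 * a ^+ 2.
  have N_eq : N = (u' + v' * a) * (u' - v' * a) by rewrite /N; ring.
  have conj_neq0 : u' - v' * a != 0.
    apply: contraNneq x_neq0 => x0.
    have ANv' : A (- v') by move: Av'; rewrite !AP rpredN.
    rewrite -mulNr in x0.
    have [-> /eqP] := quad_ext_eq0 Au' ANv' x0.
    by rewrite oppr_eq0 => /eqP->; rewrite mul0r addr0.
  (* Coordinates of the quotient after multiplying numerator and denominator by the conjugate. *)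
  exists ((u * u' - v * v' * a ^+ 2) / N), ((v * u' - u * v') / N).
  have Pa2 := Aa2; rewrite !AP in Pa2 Au Av Au' Av' *.
  have PN : N \in P.
    by apply: rpredB; [exact: rpredX|apply: rpredM => //; exact: rpredX].
  split; first (apply: rpred_div => //; apply: rpredB; first exact: rpredM).
  - by apply: rpredM => //; exact: rpredM.
  - by apply: rpred_div => //; apply: rpredB; exact: rpredM.
  - by rewrite N_eq; field; rewrite x_neq0 conj_neq0.
Qed.

(* If z = u + v a, then w is the conjugate u - v a and t the norm of z. *)
Lemma quad_ext_conj_sqr c e z : A c -> A e -> quad_ext A a z ->
    z ^+ 2 = c + e * a ->
  (exists2 w, quad_ext A a w & w ^+ 2 = c - e * a) /\
  (exists2 t, A t & t ^+ 2 = c ^+ 2 - e ^+ 2 * a ^+ 2).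
Proof.
move=> Ac Ae [u [v [Au Av ->]]] z2.
have [Au2 Av2 Auv] : [/\ A (u ^+ 2), A (v ^+ 2 * a ^+ 2) & A (2 * u * v)].
  have Pa2 := Aa2; rewrite !AP in Pa2 Au Av *; split; first exact: rpredX.
  - by apply: rpredM => //; exact: rpredX.
  - by do 2!apply: rpredM => //; exact: rpred_nat.
have [] : u ^+ 2 + v ^+ 2 * a ^+ 2 = c /\ 2 * u * v = e.
  apply: quad_ext_inj => //; first by rewrite !AP in Au2 Av2 *; exact: rpredD.
  by rewrite -z2; ring.
move=> <- <-; split.
  exists (u - v * a); last by ring.
  by exists u, (- v); rewrite mulNr; split=> //; rewrite !AP rpredN in Av *.
exists (u ^+ 2 - v ^+ 2 * a ^+ 2); last by ring.
by rewrite !AP in Au2 Av2 *; exact: rpredB.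
Qed.

End QuadraticExtension.

(** * Nonsquares in the tower of fields generated by the [alpha n] *)

Lemma sqr_rat_neq2 (q : rat) : q ^+ 2 <> 2.
Proof.
move=> q2; have n2 : (`|numq q| ^ 2 = 2 * `|denq q| ^ 2)%N.
  have /intr_inj : (numq q ^+ 2)%:~R = (2 * denq q ^+ 2)%:~R :> rat.
    by rewrite [LHS]rmorphXn intrM [X in _ = _ * X]rmorphXn/= numqE exprMn q2.
  by move=> /(congr1 absz); rewrite abszM !abszX.
have d0 : (0 < `|denq q|)%N by rewrite absz_gt0 denq_neq0.
have n0 : (0 < `|numq q|)%N.
  have : (0 < `|numq q| ^ 2)%N by rewrite n2 muln_gt0 expn_gt0 d0.
  by rewrite expn_gt0 orbF.
(* The 2-adic valuation is even on the left and odd on the right. *)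
have := congr1 (odd \o logn 2) n2.
by rewrite /= lognM ?expn_gt0 ?d0// !lognX (pfactorK 1)// oddD !oddM.
Qed.

Section Alpha.
Variable R : realType.
Implicit Types (n : nat) (z : R[i]).
Local Notation alpha := (alpha R).

Lemma alpha0 : alpha 0 = 0.
Proof.
rewrite /Defs.alpha; have -> : 2 * pi / 2 ^+ 2 = pi / 2 :> R by field.
by rewrite cos_pihalf mulr0.
Qed.

Lemma alphaS_sqr n : alpha n.+1 ^+ 2 = 2 + alpha n.
Proof.
rewrite /Defs.alpha; set x := 2 * pi / 2 ^+ n.+3 : R.
have -> : 2 * pi / 2 ^+ n.+2 = x *+ 2.
  by rewrite /x (exprS _ n.+2) -mulr_natl; field; rewrite expf_neq0.
rewrite -rmorphXn/= -[2 in RHS](rmorph_nat (real_complex R)) -rmorphD/=.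
by congr _%:C; rewrite cos_mulr2n; ring.
Qed.

Lemma alpha_ge0 n : 0 <= alpha n.
Proof.
rewrite ler0c mulr_ge0// cos_ge0_pihalf//; have pi0 := pi_ge0 R.
apply/andP; split.
  by rewrite (@le_trans _ _ 0)// ?oppr_le0 ?divr_ge0// ?mulr_ge0// exprn_ge0.
rewrite ler_pdivrMr ?exprn_gt0// exprS exprS.
have : 1 <= 2 ^+ n :> R by rewrite exprn_ege1// ler1n.
by nra.
Qed.

Lemma alpha_real n : alpha n \is Num.real.
Proof. by rewrite ger0_real// alpha_ge0. Qed.

Lemma alphaS_gt1 n : 1 < alpha n.+1.
Proof.
rewrite -(@ltr_pXn2r _ 2) ?nnegrE ?alpha_ge0// expr1n alphaS_sqr.
by rewrite (@lt_le_trans _ _ 2) ?ltr1n// lerDl alpha_ge0.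
Qed.

Fixpoint alpha_tower n : set R[i] :=
  if n is n'.+1 then quad_ext (alpha_tower n') (alpha n'.+1)
  else range ratr.

Lemma alpha_tower_mem n (A := alpha_tower n) :
    divring_closed [in A] -> A (alpha n) ->
  [/\ A 1, A 2, A (- 1) & A (alpha n.+1 ^+ 2)].
Proof.
move=> Acl /mem_set Aa; rewrite alphaS_sqr.
have [A1 _ _] := Acl; have [_ AD] := Acl : addr_closed [in A].
have A2 : 2 \in [in A] by exact: AD.
split; apply/set_mem => //; last exact: AD.
exact: (Acl : oppr_closed [in A]).
Qed.

(** The four facts need a joint induction: closure at level [n.+1] rests on [2 + alpha n] being a
    nonsquare at level [n], and for both signs the norm sends a root of [2 +- alpha n.+1] to a root
    of [2 - alpha n]. *)
Lemma alpha_towerP n :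
  [/\ divring_closed [in alpha_tower n], alpha_tower n (alpha n),
      (forall z, alpha_tower n z -> z ^+ 2 <> 2 + alpha n) &
      (forall z, alpha_tower n z -> z ^+ 2 <> 2 - alpha n)].
Proof.
elim: n => [|n [Acl Aa Np Nm]].
  (* Since [alpha 0 = 0], both signs ask for the irrationality of the square root of 2. *)
  have N2 z : range ratr z -> z ^+ 2 <> 2.
    move=> [q _ <-]; rewrite -rmorphXn/= -(rmorph_nat ratr).
    by move/fmorph_inj/sqr_rat_neq2.
  split; rewrite /= ?alpha0 ?addr0 ?subr0//; last by exists 0; rewrite ?rmorph0.
  split.
  - by apply/mem_set; exists 1; rewrite ?rmorph1.
  - move=> _ _ /set_mem[p _ <-] /set_mem[q _ <-]; apply/mem_set.
    by exists (p - q); rewrite ?rmorphB.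
  - move=> _ _ /set_mem[p _ <-] /set_mem[q _ <-]; apply/mem_set.
    by exists (p / q); rewrite ?fmorph_div.
have [A1 A2 AN1 Aa2] := alpha_tower_mem Acl Aa.
have Naa z : alpha_tower n z -> z ^+ 2 <> alpha n.+1 ^+ 2.
  by rewrite alphaS_sqr; exact: Np.
have norm_eq : 2 ^+ 2 - alpha n.+1 ^+ 2 = 2 - alpha n.
  by rewrite alphaS_sqr; ring.
split=> [||z Az z2|z Az z2] /=.
- exact: quad_ext_closed.
- exact: quad_ext_gen.
- rewrite -[alpha _]mul1r in z2.
  have [_ [t At]] := quad_ext_conj_sqr Acl Aa2 Naa A2 A1 Az z2.
  by rewrite expr1n mul1r norm_eq; exact: Nm.
- rewrite -mulN1r in z2.
  have [_ [t At]] := quad_ext_conj_sqr Acl Aa2 Naa A2 AN1 Az z2.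
  by rewrite sqrrN expr1n mul1r norm_eq; exact: Nm.
Qed.

Lemma alpha_tower_real n z : alpha_tower n z -> z \is Num.real.
Proof.
elim: n z => [_ [q _ <-]|n IH _ [u [v [/IH ur /IH vr ->]]]].
  exact: rpred_rat.
by rewrite rpredD// rpredM// alpha_real.
Qed.

(* The conjugate of a square root of 1 + alpha_n would be a real square root of
   1 - alpha_n < 0. *)
Lemma alpha_tower_sqr_neq n z : (0 < n)%N -> alpha_tower n z ->
  z ^+ 2 <> 1 + alpha n.
Proof.
case: n => // n _ Az z2.
have [Acl Aa Np _] := alpha_towerP n.
have [A1 _ _ Aa2] := alpha_tower_mem Acl Aa.
rewrite -[alpha _]mul1r in z2.
have Naa y : alpha_tower n y -> y ^+ 2 <> alpha n.+1 ^+ 2.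
  by rewrite alphaS_sqr; exact: Np.
have [[w Aw w2] _] := quad_ext_conj_sqr Acl Aa2 Naa A1 A1 Az z2.
have : 0 <= w ^+ 2.
  by rewrite real_exprn_even_ge0//; exact: (@alpha_tower_real n.+1).
by rewrite w2 mul1r subr_ge0 (lt_geF (alphaS_gt1 _)).
Qed.

End Alpha.

Lemma subring_gen_alpha (R : realType) n :
  subring_gen (alpha R n) `<=` @alpha_tower R n.
Proof.
have [Acl Aa _ _] := @alpha_towerP R n.
by apply: smallest_sub => [|_ ->//]; exact: (Acl : subring_closed _).
Qed.

Lemma subfield_gen_alpha (R : realType) n :
  subfield_gen (alpha R n) `<=` @alpha_tower R n.
Proof.
have [Acl Aa _ _] := @alpha_towerP R n.
by apply: smallest_sub => [|_ ->//].
Qed.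

(** * Equations of the variety and the recurrence for convergents *)

Section Variety.
Variable F : fieldType.
Implicit Types (b a c y x : F).

Let mul2E (A B : 'M[F]_2) i j : (A *m B) i j = A i 0 * B 0 j + A i 1 * B 1 j.
Proof.
by rewrite !mxE !big_ord_recl big_ord0 addr0; congr (_ * _ + A i _ * B _ j);
  apply: val_inj.
Qed.

Lemma invmx_Dmx y :
  invmx (Dmx y) = \matrix_(i, j) (if i == 0 then if j == 0 then 0 else 1
                                  else if j == 0 then 1 else - y).
Proof.
set J := RHS; have DJ : Dmx y *m J = 1%:M.
  apply/matrixP => -[[|[|//]] ?] -[[|[|//]] ?]; rewrite mul2E !mxE/=; ring.
have [Du _] := mulmx1_unit DJ.
by rewrite -[LHS]mulmx1 -DJ mulKmx.
Qed.

Lemma V11P c y x : V11 c (y, x) <-> x = 2 * y /\ y ^+ 2 = c - 1.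
Proof.
rewrite /V11 /PCF_variety11/= /Emx invmx_Dmx !mul2E !mxE/=.
split=> [[e1 e2 _]|[-> y2]].
  (* With [A = 1] and [B = 0] the first equation says that [E] has equal diagonal entries. *)
  have xy : x = 2 * y.
    by apply/subr0_eq/(etrans _ (etrans e1 (mul0r _))); ring.
  split=> //; apply: subr0_eq; move/eqP: e2.
  by rewrite xy eq_sym -subr_eq0 => /eqP e2; apply: etrans e2; ring.
have -> : c = y ^+ 2 + 1 by rewrite y2 subrK.
by split; ring.
Qed.

Lemma prod_pcf11 b a m :
  \prod_(i < m.+1) Dmx (pcf11 b a i) = Dmx b * Dmx a ^+ m.
Proof. by rewrite big_ord_recl/= prodr_const card_ord. Qed.

(** Since [D(b) D(a)^(m+1) = E D(b) D(a)^m], each new factor acts on the left by [E], whose entries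
    are the coefficients here. The indices start at [m.+1] because the factor [D(b)] must be
    present. *)
Lemma prod_pcf11S b a m (M := fun m => \prod_(i < m) Dmx (pcf11 b a i)) :
  M m.+2 0 0 = b * M m.+1 0 0 + (a * b + 1 - b ^+ 2) * M m.+1 1 0 /\
  M m.+2 1 0 = M m.+1 0 0 + (a - b) * M m.+1 1 0.
Proof.
rewrite /M !prod_pcf11 exprS; move: (Dmx a ^+ m) => X.
by rewrite -!mulmxE !mul2E !mxE/=; split; ring.
Qed.

End Variety.

(** * Finite values of continued fractions *)

Section Convergents.
Variable K : numFieldType.
Implicit Types (c : nat -> K) (z b a : K).

Let Mx c m : 'M[K]_2 := \prod_(i < m) Dmx (c i).

(** The image under [Some] of a neighbourhood of [z] is a neighbourhood that omits infinity, so
    convergence to a finite point forces the denominators to be eventually nonzero. *)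
Lemma cf_valueP c z : cf_value c (Some z) <->
  (\forall m \near \oo, Mx c m 1 0 != 0) /\
  Mx c m 0 0 / Mx c m 1 0 @[m --> \oo] --> z.
Proof.
split=> [cz|[q0 cz]].
  have H (U : set K) : nbhs z U ->
      \forall m \near \oo, Mx c m 1 0 != 0 /\ U (Mx c m 0 0 / Mx c m 1 0).
    move=> /one_point_compactification_some_nbhs/cz cU.
    move: cU; apply: (@filterS _ \oo%classic) => m /= [u Uu].
    rewrite /convergent -/(Mx c m).
    by case: ifP => // /negbT q [uE]; rewrite -uE.
  split; first by apply: (filterS _ (H _ filterT)) => m [].
  by move=> U /H; apply: (@filterS _ \oo%classic) => m [].
move=> U /cz cU; apply: filterS2 q0 cU => m q /=.
by rewrite /convergent -/(Mx c m) (negbTE q).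
Qed.

Lemma cf_value_fixpoint b a z : cf_value (pcf11 b a) (Some z) ->
  z ^+ 2 - a * b - 1 + b ^+ 2 + (a - 2 * b) * z = 0.
Proof.
move=> /cf_valueP[q0]; set r := fun m => _ / _ => rz.
have rSz : r m.+1 @[m --> \oo] --> z by have := rz; rewrite -cvg_shiftS.
(* The Moebius relation is cross-multiplied before passing to the limit, because [z + (a - b)] is
   not known to be nonzero. *)
have lhs : r m.+1 * (r m + (a - b)) @[m --> \oo] --> z * (z + (a - b)).
  by apply: cvgM => //; apply: cvgD => //; exact: cvg_cst.
have rhs : b * r m + (a * b + 1 - b ^+ 2) @[m --> \oo] -->
           b * z + (a * b + 1 - b ^+ 2).
  by apply: cvgD; [apply: cvgM => //|]; exact: cvg_cst.
suff /eqP : z * (z + (a - b)) = b * z + (a * b + 1 - b ^+ 2).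
  by rewrite -subr_eq0 => /eqP <-; ring.
apply: (cvg_unique (@norm_hausdorff K K^o) lhs).
apply: cvg_trans rhs; apply: near_eq_cvg; near=> m.
have m_gt0 : (0 < m)%N by near: m; exists 1%N.
have := prod_pcf11S b a m.-1; rewrite prednK// => -[pE qE].
have qm : Mx (pcf11 b a) m 1 0 != 0 by near: m.
have : Mx (pcf11 b a) m.+1 1 0 != 0.
  by near: m; case: q0 => N _ q0; exists N => // m Nm; exact/q0/leqW.
rewrite /r [Mx _ m.+1 0 0]pE [Mx _ m.+1 1 0]qE => qSm.
by field; rewrite qSm qm.
Unshelve. all: by end_near. Qed.

End Convergents.

(** * The continued fractions of the two square roots of 2 *)

Lemma cvg_real_complex (R : realType) (K := R[i] : numFieldType)
    (x : nat -> R) (t : R) :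
  x m @[m --> \oo] --> t -> ((x m)%:C : K) @[m --> \oo] --> (t%:C : K).
Proof.
move=> /cvgrPdist_lt xt; apply/(@cvgrPdist_lt K K) => e e0.
(* In the partial order on [R[i]] a positive radius is real. *)
have /complex_realP[k eE] : (e : R[i]) \is Num.real by exact: gtr0_real.
have k0 : 0 < k by rewrite -ltcR -eE.
apply: filterS (xt k k0) => m; rewrite -ltcR -eE -rmorphB.
by rewrite normc_def/= expr0n addr0 sqrtr_sqr.
Qed.

(** The convergents 1, 3/2, 7/5, ... of [[1, 2, 2, ...]], generated by the Moebius action of [E] at
    [(1, 2)]. *)
Fixpoint sqrt2_approx (R : fieldType) m : R :=
  if m is m'.+1 then (sqrt2_approx R m' + 2) / (sqrt2_approx R m' + 1) else 1.

Lemma sqrt2_approx_ge1 (R : realFieldType) m : 1 <= sqrt2_approx R m.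
Proof.
elim: m => //= m IH; rewrite ler_pdivlMr; last first.
  by rewrite ltr_wpDl// (le_trans _ IH).
by rewrite mul1r lerD2l ler1n.
Qed.

Lemma cvg_sqrt2_approx (R : realType) (t : R) : 0 <= t -> t ^+ 2 = 2 ->
  sqrt2_approx R m @[m --> \oo] --> t.
Proof.
move=> t0 t2.
have bound m : `|t - sqrt2_approx R m| <= geometric 1 (2^-1) m.
  rewrite /geometric/= mul1r.
  elim: m => /= [|m IH]; first by rewrite expr0 ler_norml; nra.
  have := sqrt2_approx_ge1 R m; set x := sqrt2_approx R m in IH * => x1.
  have x1_neq0 : x + 1 != 0 by lra.
  (* [t] is fixed by the map, so the error is multiplied by [(1 - t) / (x + 1)], at most 1/2 in
     absolute value because [x >= 1] and [0 <= t <= 2]. *)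
  have -> : t - (x + 2) / (x + 1) = (1 - t) / (x + 1) * (t - x).
    by rewrite -t2; field.
  rewrite normrM exprS ler_pM//.
  by rewrite ler_norml ler_pdivlMr ?ler_pdivrMr; nra.
apply/cvgrPdist_lt => e e0.
have /cvgrPdist_lt/(_ e e0) : geometric 1 (2^-1 : R) m @[m --> \oo] --> (0 : R).
  by apply: cvg_geometric; rewrite ger0_norm ?invr_ge0// invf_lt1 ?ltr1n.
apply: filterS => m; rewrite sub0r normrN => /(le_lt_trans _); apply.
exact: le_trans (bound m) (ler_norm _).
Qed.

(** The sign [e] treats both points [(1, 2)] and [(-1, -2)] at once: negating all partial quotients
    negates every convergent. *)
Lemma cf_value_sqrt2 (R : realType) (e : R[i]) : e ^+ 2 = 1 ->
  cf_value (pcf11 e (2 * e)) (Some (e * alpha R 1)).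
Proof.
move=> e2; pose x m : R[i] := (sqrt2_approx R m)%:C.
have xS m : x m.+1 = (x m + 2) / (x m + 1).
  by rewrite /x/= fmorph_div !rmorphD !rmorph1.
have e_neq0 : e != 0.
  by apply: contra_eq_neq e2 => ->; rewrite expr0n eq_sym oner_eq0.
have x1_neq0 m : x m + 1 != 0.
  by rewrite gt_eqF// ltr_wpDl// ler0c (le_trans _ (sqrt2_approx_ge1 R m)).
pose M m := \prod_(i < m) Dmx (pcf11 e (2 * e) i) : 'M[R[i]]_2.
(* The denominator stays nonzero because each step multiplies it by [e * (x m + 1)]. *)
have pq m : M m.+1 1 0 != 0 /\ M m.+1 0 0 = e * x m * M m.+1 1 0.
  elim: m => [|m [q0 pE]].
    by rewrite /M big_ord_recl big_ord0 mulr1 !mxE/= /x rmorph1 !mulr1 oner_neq0.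
  have [] := prod_pcf11S e (2 * e) m; rewrite -/(M m.+2) -/(M m.+1) => -> ->.
  rewrite pE xS; set q := M m.+1 1 0 in q0 *.
  have -> : e * x m * q + (2 * e - e) * q = e * (x m + 1) * q by ring.
  split; first by rewrite !mulf_neq0.
  have -> : e * (e * x m * q) + (2 * e * e + 1 - e ^+ 2) * q =
            (e ^+ 2 * x m + e ^+ 2 + 1) * q by ring.
  have -> : e * ((x m + 2) / (x m + 1)) * (e * (x m + 1) * q) =
            e ^+ 2 * (x m + 2) * q by field; exact: x1_neq0.
  by rewrite e2; ring.
apply/cf_valueP; split.
  (* The empty product is the identity matrix, whose convergent is infinite, so indices start at
     1. *)
  by exists 1%N => // -[//|m] _; have [] := pq m.
rewrite -cvg_shiftS.
rewrite (_ : [sequence _]_n = fun m => e * x m); last first.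
  by apply/funext => m /=; have [q0 pE] := pq m; rewrite -/(M _) pE mulfK.
apply: cvgM; first exact: cvg_cst.
apply: cvg_real_complex; apply: cvg_sqrt2_approx.
  by rewrite -ler0c; exact: alpha_ge0.
apply: complexI; rewrite rmorphXn/= -/(alpha R 1).
by rewrite [LHS]alphaS_sqr alpha0 addr0 rmorph_nat.
Qed.

(** * From continued fractions to points of the variety, and the final count *)

Lemma is_PCF11_V11 (R : realType) n (b a : R[i]) :
  is_PCF11 n b a -> V11 (2 + alpha R n) (b, a).
Proof.
move=> [/subring_gen_alpha Ab /subring_gen_alpha Aa /cf_value_fixpoint fix_eq].
have [Acl Aalpha Np _] := @alpha_towerP R n.
have [A1 A2 _ _] := alpha_tower_mem Acl Aalpha.
have Naa z : alpha_tower n z -> z ^+ 2 <> alpha R n.+1 ^+ 2.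
  by rewrite alphaS_sqr; exact: Np.
have [_ AD] := Acl : addr_closed _.
have AN := Acl : oppr_closed _.
have [_ AM] := Acl : mulr_closed _.
(* Once [alpha R n.+1 ^+ 2] is replaced by [2 + alpha R n], the fixed-point equation is linear in
   [alpha R n.+1] with these two coefficients in the tower. *)
have [] := @quad_ext_eq0 _ _ (alpha R n.+1) Acl Naa
    (2 + alpha R n - a * b - 1 + b ^+ 2) (a - 2 * b).
- apply: set_mem; apply: (AD); last by apply: (AM); exact: mem_set.
  apply: (AD); last by apply: (AN); exact: mem_set.
  apply: (AD); last by apply: (AN); apply: (AM); exact: mem_set.
  by apply: (AD); exact: mem_set.
- by apply: set_mem; apply: (AD); [|apply: (AN); apply: (AM)]; exact: mem_set.
- by rewrite -alphaS_sqr.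
move=> c0 /subr0_eq aE; apply/V11P; split=> //.
by apply/esym/subr0_eq/(etrans _ c0); rewrite aE; ring.
Qed.

Lemma sqr_eq_sqr (F : fieldType) (x y : F) :
  x ^+ 2 = y ^+ 2 <-> x = y \/ x = - y.
Proof.
split=> [/eqP|[->|->]]; rewrite ?sqrrN// eqf_sqr.
by move=> /orP[] /eqP ->; [left|right].
Qed.

Theorem proposition5p3 (R : realType) :
  (* (1) *)
  ((forall n : nat,
      let s := sqrtC (1 + alpha R n) in
      [/\ (V11 (2 + alpha R n) #= `I_2)%card,
          V11 (2 + alpha R n) =
            [set p : R[i] * R[i] |
               (p.2 = 2 * s \/ p.2 = - (2 * s)) /\ p.1 = p.2 / 2] &
          (1 <= n)%N ->
          forall b a : R[i], V11 (2 + alpha R n) (b, a) ->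
            ~ (subfield_gen (alpha R n) b /\ subfield_gen (alpha R n) a)])
   /\ 2 + alpha R 0 = 2
   /\ V11 (2 : R[i]) = [set (1, 2); (- 1, - 2)]) /\
  (* (2) *)
  ((forall (n : nat) (b a : R[i]), (1 <= n)%N -> ~ is_PCF11 n b a)
   /\ (forall b a : R[i], is_PCF11 0 b a <-> b = 1 /\ a = 2)
   /\ cf_value (pcf11 (1 : R[i]) 2) (Some (sqrtC 2))).
Proof.
have V11E n (s := sqrtC (1 + alpha R n)) (p : R[i] * R[i]) :
    V11 (2 + alpha R n) p <-> p.2 = 2 * p.1 /\ (p.1 = s \/ p.1 = - s).
  case: p => y x; have := V11P (2 + alpha R n) y x.
  have -> : 2 + alpha R n - 1 = s ^+ 2 by rewrite sqrtCK; ring.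
  by rewrite sqr_eq_sqr.
have s_neq0 n : sqrtC (1 + alpha R n) != 0.
  by rewrite sqrtC_eq0 gt_eqF// ltr_wpDr// alpha_ge0.
have c2 : 2 + alpha R 0 = 2 by rewrite alpha0 addr0.
have V0 (p : R[i] * R[i]) :
    V11 (2 + alpha R 0) p <-> p = (1, 2) \/ p = (- 1, - 2).
  rewrite V11E alpha0 addr0 sqrtC1; case: p => y x /=.
  split=> [[-> [->|->]]|[[-> ->]|[-> ->]]].
  - by left; rewrite mulr1.
  - by right; rewrite mulrN1.
  - by rewrite mulr1; split=> //; left.
  - by rewrite mulrN1; split=> //; right.
have sqrt2E : alpha R 1 = sqrtC 2.
  by rewrite -[LHS]sqrCK ?alpha_ge0// alphaS_sqr alpha0 addr0.
have cf12 : cf_value (pcf11 (1 : R[i]) 2) (Some (alpha R 1)).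
  by have := @cf_value_sqrt2 R 1; rewrite mul1r mulr1; apply; rewrite expr1n.
have two_neq0 : 2 != 0 :> R[i] by rewrite pnatr_eq0.
split; split.
- move=> n s; split=> [||n_gt0 b a].
  + have -> : V11 (2 + alpha R n) = [set (s, 2 * s)] `|` [set (- s, 2 * - s)].
      apply/seteqP; split=> -[y x] /=; rewrite V11E/=.
        by move=> [-> [->|->]]; [left|right].
      by move=> [[-> ->]|[-> ->]]; split=> //; [left|right].
    apply/eq_cardSP; exists (s, 2 * s); first by left.
    rewrite (_ : _ `\ _ = [set (- s, 2 * - s)]) ?card_set1//.
    apply/seteqP; split=> p /=; first by move=> [[|]].
    move=> ->; split; first by right.
    (* The two points coincide only if [- s = s], which forces [s = 0]. *)
    case=> /eqP; rewrite eq_sym -subr_eq0 opprK -mulr2n mulrn_eq0/=.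
    by rewrite (negbTE (s_neq0 n)).
  + apply/seteqP; split=> -[y x] /=; rewrite V11E/=.
      move=> [-> ys]; split; last by rewrite mulrC mulKf.
      by case: ys => ->; [left|right; rewrite mulrN].
    move=> [xs ->]; split; first by rewrite mulrC divfK.
    by case: xs => ->; [left|right; rewrite -mulrN]; rewrite mulrC mulKf.
  (* Already the first coordinate is impossible: its square is [1 + alpha R n]. *)
  + rewrite V11P => -[_ b2] [/subfield_gen_alpha Ab _].
    apply: (alpha_tower_sqr_neq n_gt0 Ab).
    by rewrite b2; ring.
- split=> //.
  by rewrite c2 in V0; apply/seteqP; split=> p /=; rewrite V0.
- move=> n b a n_gt0 Hba; have [Ab _ _] := Hba.
  have [_ b2] := (V11P _ _ _).1 (is_PCF11_V11 Hba).
  apply: (alpha_tower_sqr_neq n_gt0 (subring_gen_alpha Ab)).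
  by rewrite b2; ring.
split; last by rewrite -sqrt2E.
move=> b a; split.
  (* The point [(-1, -2)] is excluded by its value [- alpha R 1]: uniqueness of limits would give
     [alpha R 1 = - alpha R 1], although [alpha R 1 > 0]. *)
  move=> Hba; have /V0[[-> ->]//|[bE aE]] := is_PCF11_V11 Hba.
  have [_ _ /cf_valueP[_]] := Hba; rewrite bE aE => cvgp.
  have := @cf_value_sqrt2 R (- 1); rewrite sqrrN expr1n mulrN1 mulN1r.
  move=> /(_ erefl)/cf_valueP[_ cvgn].
  have alphaN : alpha R 1 = - alpha R 1.
    exact: (cvg_unique (@norm_hausdorff (R[i] : numFieldType)
      (R[i] : numFieldType)^o) cvgp cvgn).
  have a1_gt0 : 0 < alpha R 1 by exact: lt_trans (alphaS_gt1 R 0).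
  by move/eqP: alphaN; rewrite -addr_eq0 gt_eqF// addr_gt0.
move=> [-> ->]; split=> //.
- by move=> A [[/set_mem]].
(* Every subring contains [2 = 1 + 1]. *)
- move=> A [/= Acl _]; have [A1 _ _] := Acl.
  have [_ AD] := (Acl : subring_closed [in A]) : addr_closed [in A].
  by apply: set_mem; exact: (AD 1 1).
Qed.
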